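(* There is an absolute constant $C$ such that the following holds for every prime $p$. If $\mathcal{H}\subseteq\mathbb{F}_p$ is a Hilbert cube with $$\#\mathcal{H}\ge C\,p^{11/12},$$ then $\mathcal{H}$ is not contained in a coset $\lambda\mathcal{G}$, $\lambda\in\mathbb{F}_p^*$, of any proper multiplicative subgroup $\mathcal{G}\subsetneq\mathbb{F}_p^*$.
   Context: $\mathbb{F}_p$ is the finite field with $p$ elements, $\mathbb{F}_p^*$ is its multiplicative group, $\#S$ denotes the cardinality of a finite set $S$, and $\lambda\mathcal{G}=\{\lambda g:\ g\in\mathcal{G}\}$. A Hilbert cube (of dimension $d$, where $d\ge 0$ is an integer) in $\mathbb{F}_p$ is a set of the form $$\left\{a_0+\sum_{i=1}^d\varepsilon_i a_i:\ \varepsilon_i\in\{0,1\}\right\}$$ for some elements $a_0,a_1,\ldots,a_d\in\mathbb{F}_p$ (not necessarily distinct or non-zero). The dimension $d$ is arbitrary, and the cardinality is that of the resulting set. *)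

(* Defs.v *)
From HB Require Import structures.
From mathcomp Require Import all_boot all_order all_algebra all_fingroup all_field.
From mathcomp Require Import all_reals exp.

Set Implicit Arguments.
Unset Strict Implicit.
Unset Printing Implicit Defensive.

Import GRing.Theory.
Local Open Scope ring_scope.

Definition hilbert_cube (V : finZmodType) (d : nat) (a0 : V)
    (a : 'I_d -> V) : {set V} :=
  [set a0 + \sum_(i < d) a i *+ eps i | eps : {ffun 'I_d -> bool}].

Definition is_hilbert_cube (V : finZmodType) (H : {set V}) : Prop :=
  exists (d : nat) (a0 : V) (a : 'I_d -> V), H = hilbert_cube a0 a.

(* The coset of a group of units, as a set of elements of the ring itself. *)
Definition unit_coset (A : finUnitRingType) (l : {unit A})
    (G : {set {unit A}}) : {set A} :=
  [set val l * val g | g in G].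

(* Main.v *)
Require Import Defs.
From HB Require Import structures.
From mathcomp Require Import all_boot all_order all_algebra all_fingroup all_field.
From mathcomp Require Import all_reals exp.
From mathcomp Require Import all_solvable zify ring.

Set Implicit Arguments.
Unset Strict Implicit.
Unset Printing Implicit Defensive.

Import GRing.Theory.
Local Open Scope ring_scope.

(** Let [m] be the order of the subgroup. Peeling off generators one at a time
    writes the cube as [A + B] with [k = #|B|] of order [p ^ (1/12)], so it
    suffices to bound [#|A|] by [O(p / k ^ 2)]; this is done by Stepanov's
    method. On [A] every [(x + b) ^ m], [b] in [B], takes the same value [mu].
    Consider [F = \sum_S c_S f_S], over the pairs [S] in [B], with
    [f_S = \prod_(b in S) (x + b) ^ m] of degree [2 m < p] and polynomials [c_S]
    of small degree. Iterated derivatives of [F] have, up to a power of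
    [P = \prod_b (x + b)], the same shape; at a point of [A] each [f_S] is
    [mu ^ 2], so killing the sums of their coefficients, which is a linear system
    in the [c_S], makes [F] vanish there to order about [k ^ 2 / 4].
    Finally [F != 0] because the Wronskian of the functions [c_S f_S] is nonzero:
    otherwise two of its minors have as quotient a solution of the differential
    equation of [f_S / f_S'], and their low degree contradicts the exponent [m]
    of that equation at a point of the symmetric difference of [S] and [S']. *)

(** * Degrees, multiplicities and logarithmic derivatives of polynomials *)

Lemma size_det_leq (F : fieldType) (r E : nat) (A : 'M[{poly F}]_r) :
  (forall i j, (size (A i j) <= E.+1)%N) -> (size (\det A) <= (r * E).+1)%N.
Proof.
move=> sA; apply: leq_trans (size_sum _ _ _) _; apply/bigmax_leqP => s _.
rewrite -signr_odd mulr_sign; case: ifP => _; rewrite ?size_polyN.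
all: apply: leq_trans (size_poly_prod_leq _ _) _; rewrite card_ord /=.
all: rewrite leq_subLR addnS ltnS.
all: apply: (@leq_trans (\sum_(i < r) E.+1)); first exact: leq_sum.
all: by rewrite sum_nat_const card_ord mulnS.
Qed.

Lemma mup_factor (F : fieldType) (z : F) (u : {poly F}) : u != 0 ->
  exists2 u0 : {poly F}, ~~ root u0 z & u = u0 * ('X - z%:P) ^+ mup z u.
Proof.
move=> u_neq0; have [n [u0]] := multiplicity_XsubC u z.
rewrite u_neq0 /= => nroot def_u.
exists u0 => //; rewrite {2}def_u mupMr //.
by rewrite mup_XsubCX eqxx.
Qed.

Lemma deriv_XsubC_exp (F : fieldType) (z : F) (n : nat) :
  ('X - z%:P) * (('X - z%:P) ^+ n)^`() = ('X - z%:P) ^+ n *+ n.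
Proof.
rewrite deriv_exp derivXsubC mul1r mulrnAr.
by case: n => [|n]; rewrite ?mulr0n // -exprS.
Qed.

(* The local exponent at [z] of a solution of [y' / y = q / (('X - z) g)] is
   [q(z) / g(z)]; here [q = q1 - q2] and [y = v / u]. *)
Lemma mup_logderiv (F : fieldType) (z : F) (g q1 q2 u v : {poly F}) :
  u != 0 -> v != 0 ->
  u * (('X - z%:P) * g * v^`() - q1 * v)
    = v * (('X - z%:P) * g * u^`() - q2 * u) ->
  g.[z] *+ mup z v + q2.[z] = g.[z] *+ mup z u + q1.[z].
Proof.
move=> u0 v0; have [u1 ru defu] := mup_factor z u0.
have [v1 rv defv] := mup_factor z v0.
move: (mup z u) (mup z v) defu defv => a b -> ->.
have dL := deriv_XsubC_exp z; have Lneq0 n : ('X - z%:P) ^+ n != 0.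
  by rewrite expf_neq0 // polyXsubC_eq0.
have Lz : ('X - z%:P).[z] = 0 by rewrite hornerXsubC subrr.
move: ('X - z%:P) dL Lneq0 Lz => L dL Lneq0 Lz; rewrite !derivM => eq1.
(* The derivation [L * g * d/dx] preserves the power of [L], so a common power cancels and
   evaluation at [z] kills the terms still carrying [L]. *)
have e n w : L * g * (w^`() * L ^+ n + w * (L ^+ n)^`())
    = (g * w *+ n + L * g * w^`()) * L ^+ n.
  rewrite mulrDr addrC mulrDl; congr (_ + _); last by rewrite mulrA.
  rewrite mulrnAl -mulrnAr -dL; move: ((L ^+ n)^`()) => y; rewrite -!mulrA mulrCA.
  by congr (_ * _); rewrite mulrCA.
move: eq1; rewrite !e !mulrA -!mulrBl => eq1.
have : (u1 * (g * v1 *+ b + L * g * v1^`() - q1 * v1)) * (L ^+ a * L ^+ b)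
     = (v1 * (g * u1 *+ a + L * g * u1^`() - q2 * u1)) * (L ^+ a * L ^+ b).
  rewrite mulrACA eq1 [X in _ = _ * X]mulrC.
  by rewrite mulrACA.
move/mulIf => /(_ _)/(congr1 (fun w => w.[z])); rewrite mulf_neq0 // => /(_ isT).
rewrite !(hornerE, hornerMn) Lz !mul0r !addr0 => eq2.
have nz : u1.[z] * v1.[z] != 0 by rewrite mulf_neq0.
apply: (mulfI nz); apply/eqP; rewrite -subr_eq0; apply/eqP.
move/eqP: eq2; rewrite -subr_eq0 => /eqP <-.
rewrite -(mulr_natr g.[z]) -(mulr_natr (g.[z] * v1.[z])).
by rewrite -(mulr_natr g.[z]) -(mulr_natr (g.[z] * u1.[z])); ring.
Qed.

Lemma mup_lt_size (F : fieldType) (z : F) (u : {poly F}) :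
  u != 0 -> (mup z u < size u)%N.
Proof.
move=> u_neq0; have := dvdp_leq u_neq0 (_ : ('X - z%:P) ^+ mup z u %| u).
by rewrite -mup_geq // leqnn size_exp_XsubC => /(_ isT).
Qed.

Lemma natr_inj_pchar (R : nzRingType) (p a b : nat) :
  p \in [pchar R] -> (a < p)%N -> (b < p)%N -> a%:R = b%:R :> R -> a = b.
Proof.
move=> charp; wlog le_ab : a b / (a <= b)%N => [hw|] lt_a lt_b eq_ab.
  by case/orP: (leq_total a b) => /hw h; [|symmetry]; apply: h.
have : (p %| b - a)%N by rewrite (dvdn_pcharf charp) natrB // eq_ab subrr.
move/dvdnP => [[|k]]; rewrite ?mul0n ?mulSn; lia.
Qed.

(** * The connection with flat sections [\prod_(t in S) (x - z t) ^ m] *)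

Section Connection.
Variables (F : fieldType) (I : finType) (z : I -> F) (m : nat).

Definition node_poly : {poly F} := \prod_(t : I) ('X - (z t)%:P).

Definition node_cofactor t : {poly F} := \prod_(s | s != t) ('X - (z s)%:P).

Definition node_power (S : {set I}) : {poly F} :=
  \prod_(t in S) ('X - (z t)%:P) ^+ m.

(** The logarithmic derivative of [node_power S], cleared of the denominator [node_poly]. *)
Definition node_logder (S : {set I}) : {poly F} :=
  \sum_(t in S) node_cofactor t *+ m.

(** The derivation [node_poly * d/dx] conjugated by [node_power S]: it acts on coefficients alone,
    so degrees stay independent of [m]. *)
Definition node_deriv (S : {set I}) (c : {poly F}) : {poly F} :=
  node_poly * c^`() + node_logder S * c.

Lemma node_polyD1 t : node_poly = ('X - (z t)%:P) * node_cofactor t.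
Proof. by rewrite /node_poly (bigD1 t). Qed.

Lemma deriv_node_power S :
  node_poly * (node_power S)^`() = node_logder S * node_power S.
Proof.
rewrite /node_power /node_logder -!big_enum /=.
elim: (enum S) => [|t r IH].
  by rewrite !big_nil derivC mulr0 mul0r.
rewrite !big_cons derivM mulrDr mulrDl; congr (_ + _).
  rewrite mulrA (node_polyD1 t) [_ * node_cofactor t]mulrC -[_ * _ * _^`()]mulrA.
  by rewrite deriv_XsubC_exp mulrnAr !mulrnAl mulrA.
by rewrite mulrCA IH mulrCA.
Qed.

Lemma node_derivE S c :
  node_poly * (c * node_power S)^`() = node_deriv S c * node_power S.
Proof.
rewrite derivM mulrDr [X in _ + X]mulrCA deriv_node_power /node_deriv mulrDl.
by rewrite !mulrA [c * _]mulrC.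
Qed.

(** For distinct nodes, the logarithmic derivative of [node_power S] has residue [m] or [0] at
    [z t], which later tells two sets apart. *)
Lemma horner_node_logder S t :
  (node_logder S).[z t] = (node_cofactor t).[z t] *+ (m * (t \in S)).
Proof.
have vanish s : t != s -> (node_cofactor s).[z t] = 0.
  move=> ts; rewrite /node_cofactor (bigD1 t) //= hornerM.
  by rewrite hornerXsubC subrr mul0r.
rewrite /node_logder horner_sum; case: (boolP (t \in S)) => tS.
  rewrite (bigD1 t tS) /= big1 ?addr0 ?muln1 ?hornerMn // => s /andP[_ st].
  by rewrite hornerMn vanish 1?eq_sym // mul0rn.
rewrite muln0 mulr0n big1 // => s sS.
by rewrite hornerMn vanish ?mul0rn //; apply: contraNneq tS => ->.
Qed.

Lemma node_cofactor_neq0 t : injective z -> (node_cofactor t).[z t] != 0.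
Proof.
move=> z_inj; rewrite horner_prod; apply/prodf_neq0 => s st.
by rewrite hornerXsubC subr_eq0 (inj_eq z_inj) eq_sym.
Qed.

Lemma size_node_poly : size node_poly = #|I|.+1.
Proof.
rewrite /node_poly size_prod_XsubC; congr _.+1.
by rewrite cardE enumT.
Qed.

Lemma size_node_cofactor t : size (node_cofactor t) = #|I|.
Proof.
apply: succn_inj; rewrite -size_node_poly (node_polyD1 t).
have cof_neq0 : node_cofactor t != 0.
  by apply/prodf_neq0 => s _; rewrite polyXsubC_eq0.
by rewrite size_mul ?polyXsubC_eq0 // size_XsubC.
Qed.

Lemma size_node_deriv S c : (size (node_deriv S c) <= size c + #|I|)%N.
Proof.
apply: leq_trans (size_polyD _ _) _; rewrite geq_max; apply/andP; split.
  apply: leq_trans (size_polyMleq _ _) _; rewrite size_node_poly addSn /= addnC.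
  rewrite leq_add2r; have [->|c_neq0] := eqVneq c 0; first by rewrite derivC.
  exact: ltnW (lt_size_deriv c_neq0).
apply: leq_trans (size_polyMleq _ _) _; apply: leq_trans (leq_pred _) _.
rewrite addnC leq_add2l; apply: leq_trans (size_sum _ _ _) _.
apply/bigmax_leqP => t _; rewrite -(size_node_cofactor t) -mulr_natr -polyC_natr.
by rewrite mulrC mul_polyC; apply: size_scale_leq.
Qed.

Lemma size_iter_node_deriv S c j :
  (size (iter j (node_deriv S) c) <= size c + j * #|I|)%N.
Proof.
elim: j => [|j IH] /=; first by rewrite addn0.
apply: leq_trans (size_node_deriv _ _) _.
by rewrite mulSn [(#|I| + _)%N]addnC addnA leq_add2r.
Qed.

(** With column [i] multiplied by [node_power (S i)], this is the Wronskian of the products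
    [c i * node_power (S i)] for [node_poly * d/dx]. *)
Definition node_wronskian r (S : 'I_r -> {set I}) (c : 'I_r -> {poly F}) :=
  \matrix_(j < r, i < r) iter j (node_deriv (S i)) (c i).

(** Induction on [r]. If the determinant vanished, the cofactors [u i] of the last row would form a
    kernel vector, and [y = u i / u ord0] would solve [P y' = (q_i - q_0) y]. At a node of the
    symmetric difference its exponent is [m] up to sign, too large for minors of low degree. *)
Lemma det_node_wronskian_neq0 p D r (S : 'I_r -> {set I}) (c : 'I_r -> {poly F}) :
    p \in [pchar F] -> injective z -> injective S ->
    (forall i, c i != 0) -> (forall i, size (c i) <= D)%N ->
    (r * (D + r * #|I|) < m)%N -> (m + r * (D + r * #|I|) < p)%N ->
  \det (node_wronskian S c) != 0.
Proof.
move=> charp z_inj; elim: r => [|r IH] in S c *.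
  by rewrite det_mx00 oner_eq0.
move=> S_inj c_neq0 sc ltm ltp; set W := node_wronskian S c.
(* Such a minor is the Wronskian of the remaining functions. *)
have minor_neq0 i : \det (row' ord_max (col' i W)) != 0.
  have -> : row' ord_max (col' i W)
      = node_wronskian (S \o lift i) (c \o lift i).
    by apply/matrixP => j k; rewrite !mxE /= /bump leqNgt ltn_ord.
  apply: IH => //=; first exact: inj_comp S_inj lift_inj.
    apply: leq_ltn_trans ltm; apply: leq_mul => //.
    by rewrite leq_add2l leq_mul.
  apply: leq_ltn_trans ltp; rewrite leq_add2l; apply: leq_mul => //.
  by rewrite leq_add2l leq_mul.
have [r0|r_gt0] := posnP r.
  rewrite /W; move: S c S_inj c_neq0 {sc ltm ltp W minor_neq0 IH}; rewrite r0.
  by move=> S c _ c_neq0; rewrite det_mx11 mxE /=; apply: c_neq0.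
apply/eqP => detW0.
pose u i : {poly F} := cofactor W ord_max i.
have u_neq0 i : u i != 0 by rewrite mulf_neq0 // signr_eq0.
have mup_u x i : (mup x (u i) <= r.+1 * (D + r.+1 * #|I|))%N.
  rewrite -ltnS; apply: leq_trans (mup_lt_size _ (u_neq0 i)) _.
  suff sdet : (size (\det (row' ord_max (col' i W))) <=
               (r.+1 * (D + r.+1 * #|I|)).+1)%N.
    rewrite /u /cofactor -signr_odd mulr_sign.
    by case: ifP => _; rewrite ?size_polyN.
  apply: leq_trans (size_det_leq (E := D + r.+1 * #|I|) _) _; last first.
    by rewrite ltnS leq_mul.
  move=> j k; rewrite !mxE; apply: leq_trans (size_iter_node_deriv _ _ _) _.
  by apply: leqW; rewrite leq_add // leq_mul // ltnW.
pose n j i := iter j (node_deriv (S i)) (c i).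
have kerW j : (j < r.+1)%N -> \sum_i n j i * u i = 0.
  move=> lt_j.
  have := congr1 (fun A : 'M_r.+1 => A (Ordinal lt_j) ord_max) (mul_mx_adj W).
  rewrite /= detW0 !mxE mul0rn => eq0; rewrite -[RHS]eq0; apply: eq_bigr => i _.
  by rewrite !mxE.
(* Adjoint operator: [P (x y)' = node_deriv (S i) x * y + x * dual i y]. Differentiating a kernel
   relation and subtracting the next one gives a relation for the [dual i (u i)], at the cost of one
   row. *)
pose dual i x := node_poly * x^`() - node_logder (S i) * x.
have kerD j : (j < r)%N -> \sum_i n j i * dual i (u i) = 0.
  move=> lt_j; have := congr1 (fun x => node_poly * x^`()) (kerW j (ltnW lt_j)).
  rewrite derivC mulr0 linear_sum mulr_sumr => eq0.
  transitivity (\sum_i n j.+1 i * u i + \sum_i n j i * dual i (u i)).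
    by rewrite kerW ?add0r.
  rewrite -big_split /= -[RHS]eq0.
  apply: eq_bigr => i _; rewrite /= derivM /n -/(n j i) /node_deriv /dual.
  move: (node_poly) (node_logder _) (n j i) (u i) => P q x y.
  by rewrite mulrDl mulrBr mulrDr !mulrA [x * P]mulrC [x * q]mulrC; ring.
(* This combination cancels coordinate [ord0]; the others are killed by a minor with nonzero
   determinant, so the ratio of [dual i (u i)] to [u i] does not depend on [i]. *)
pose w i := u ord0 * dual i (u i) - dual ord0 (u ord0) * u i.
have w0 : w ord0 = 0 by rewrite /w mulrC subrr.
have kerw j : (j < r)%N -> \sum_i n j i * w i = 0.
  move=> lt_j.
  transitivity (u ord0 * (\sum_i n j i * dual i (u i))
                - dual ord0 (u ord0) * \sum_i n j i * u i).
    rewrite !mulr_sumr -sumrB; apply: eq_bigr => i _.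
    by rewrite /w mulrBr !(mulrCA (n j i)).
  by rewrite kerD // kerW ?mulr0 ?subrr // ltnW.
have w_eq0 i : w (lift ord0 i) = 0.
  set B := row' ord_max (col' ord0 W).
  have Bw : B *m (\col_k w (lift ord0 k)) = 0.
    apply/matrixP => j k; rewrite !mxE -[RHS](kerw j (ltn_ord j)).
    rewrite big_ord_recl w0 mulr0 add0r; apply: eq_bigr => l _.
    by rewrite !mxE /= /bump leqNgt ltn_ord.
  have := congr1 (fun v => (\adj B *m v) i ord0) Bw.
  rewrite /= mulmxA mul_adj_mx mul_scalar_mx mulmx0 !mxE => /eqP.
  by rewrite mulf_eq0 (negPf (minor_neq0 ord0)) => /eqP.
pose i1 := lift ord0 (Ordinal r_gt0).
have [t tS] : exists t, (t \in S ord0) != (t \in S i1).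
  apply/existsP; rewrite -negb_forall; apply: contraTN isT => /forallP eqS.
  suff : ord0 = i1 by move/(congr1 val).
  by apply: S_inj; apply/setP => t; apply/eqP.
have := w_eq0 (Ordinal r_gt0); rewrite -/i1 /w /dual => /eqP.
rewrite subr_eq0 [X in _ == X]mulrC (node_polyD1 t) => /eqP.
move/(mup_logderiv (u_neq0 ord0) (u_neq0 i1)).
rewrite !horner_node_logder -!mulrnDr -[LHS]mulr_natr -[RHS]mulr_natr.
(* Both sides are below [p], so equality in [F] is equality of integers, and one multiplicity would
   be at least [m]. *)
have small (b : bool) i : (mup (z t) (u i) + m * b < p)%N.
  have := mup_u (z t) i; case: b; rewrite ?muln1 ?muln0; lia.
move/(mulfI (node_cofactor_neq0 t z_inj)).
move/(natr_inj_pchar charp (small _ _) (small _ _)).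
move: (mup_u (z t) ord0) (mup_u (z t) i1) ltm => {small}.
case: (t \in S ord0) tS; case: (t \in S i1) => //= _; rewrite muln0 muln1.
  by lia.
by lia.
Qed.
End Connection.

(** * Vanishing order from iterated derivatives, and root counting *)

Lemma leq_mup_iter (F : fieldType) (p M : nat) (a : F) (g u : {poly F}) :
    p \in [pchar F] -> (M <= p)%N -> g.[a] != 0 -> u != 0 ->
    (forall j, (j < M)%N -> (iter j (fun x => g * x^`()) u).[a] = 0) ->
  (M <= mup a u)%N.
Proof.
move=> charp le_Mp ga; elim: M le_Mp u => [//|M IH] lt_Mp u u_neq0 vanish.
rewrite leqNgt; apply/negP; rewrite ltnS => le_aM.
have [u0 ru defu] := mup_factor a u_neq0.
have [n defn] : exists n, mup a u = n.+1.
  exists (mup a u).-1; rewrite prednK // -XsubC_dvd // dvdp_XsubCl.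
  by apply/rootP/(vanish 0).
rewrite defn in defu le_aM.
(* As [n.+1 < p], this cofactor is nonzero at [a]: the derivation lowers the multiplicity by exactly
   one. *)
pose v := g * (u0 *+ n.+1 + ('X - a%:P) * u0^`()).
have va : v.[a] != 0.
  rewrite !(hornerE, hornerMn) subrr mul0r addr0 -mulr_natr.
  rewrite !mulf_neq0 // -(dvdn_pcharf charp) gtnNdvd //.
  exact: leq_ltn_trans le_aM lt_Mp.
have v_neq0 : v != 0 by apply: contraNneq va => ->; rewrite horner0.
have def_du : g * u^`() = v * ('X - a%:P) ^+ n.
  rewrite defu derivM deriv_exp derivXsubC mul1r exprS /v.
  rewrite -[RHS]mulrA /= [in RHS]mulrDl addrC; congr (_ * (_ + _)).
    by rewrite mulrnAr mulrnAl.
  by rewrite mulrCA mulrA.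
have mup_du : mup a (g * u^`()) = n.
  by rewrite def_du mupMr // mup_XsubCX eqxx.
have : (M <= mup a (g * u^`()))%N.
  apply: IH (ltnW lt_Mp) _ _ _.
    by rewrite def_du mulf_neq0 // expf_neq0 // polyXsubC_eq0.
  by move=> j lt_j; rewrite -iterSr; apply: vanish.
by rewrite mup_du leqNgt le_aM.
Qed.

Lemma size_mup_roots (F : fieldType) (M : nat) (A : seq F) (u : {poly F}) :
  uniq A -> u != 0 -> (forall a, a \in A -> M <= mup a u)%N ->
  (size A * M < size u)%N.
Proof.
elim: A u => [|a A IH] u /=; first by rewrite mul0n size_poly_gt0.
case/andP=> aA uA u_neq0 le_mup.
have : ('X - a%:P) ^+ M %| u by rewrite -mup_geq // le_mup ?mem_head.
case/dvdpP => v defv; have v_neq0 : v != 0.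
  by apply: contraNneq u_neq0 => v0; rewrite defv v0 mul0r.
have -> : size u = (size v + M)%N.
  rewrite defv size_mul ?expf_neq0 ?polyXsubC_eq0 // size_exp_XsubC.
  by rewrite addnS.
rewrite mulSn addnC ltn_add2r; apply: IH => // b bA.
have := le_mup b; rewrite inE bA orbT defv mupMl //; first exact.
case: (M) => [|N]; first by rewrite root1.
by rewrite root_exp_XsubC; apply: contraNneq aA => <-.
Qed.

(** * Stepanov's method *)

Section Stepanov.
Variables (F : fieldType) (I : finType) (z : I -> F) (m : nat).

Lemma iter_node_deriv_linear S j (a : F) (c d : {poly F}) :
  iter j (node_deriv z m S) (a *: c + d)
  = a *: iter j (node_deriv z m S) c + iter j (node_deriv z m S) d.
Proof.
elim: j => //= j ->; rewrite /node_deriv derivD derivZ !mulrDr -!scalerAr.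
by rewrite scalerDr addrACA.
Qed.

(** Dimension count: [r * D] free coefficients against [M * (D + M * #|I|)] linear equations. These
    are polynomial identities, so their number does not grow with the set of points where vanishing
    is wanted. *)
Lemma ex_node_relation r M D (S : 'I_r -> {set I}) :
    (M * (D + M * #|I|) < r * D)%N ->
  exists c : 'I_r -> {poly F},
    [/\ exists i, c i != 0, forall i, (size (c i) <= D)%N &
        forall j, (j < M)%N -> \sum_i iter j (node_deriv z m (S i)) (c i) = 0].
Proof.
set E := (D + _)%N => lt_dim.
pose rel (A : 'M[F]_(r, D)) j :=
  \sum_i iter j (node_deriv z m (S i)) (rVpoly (row i A)).
pose g (A : 'M[F]_(r, D)) : 'M[F]_(M, E) := \matrix_(j, l) (rel A j)`_l.
have g_lin : linear g.
  move=> a A B; apply/matrixP => j l; rewrite !mxE -coefZ -coefD.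
  suff -> : rel (a *: A + B) j = a *: rel A j + rel B j by [].
  rewrite /rel scaler_sumr -big_split; apply: eq_bigr => i _ /=.
  by rewrite !linearP iter_node_deriv_linear.
pose gL : {linear 'M[F]_(r, D) -> 'M[F]_(M, E)} :=
  HB.pack g (GRing.isLinear.Build F _ _ _ g g_lin).
have : kermx (lin_mx gL) != 0.
  rewrite -mxrank_eq0 mxrank_ker -lt0n subn_gt0.
  exact: leq_ltn_trans (rank_leq_col _) lt_dim.
case/rowV0Pn => v /sub_kermxP vker v_neq0.
pose A := vec_mx v; have gA0 : g A = 0.
  apply: (can_inj mxvecK); rewrite -[g A]/(gL A) -mul_vec_lin vec_mxK vker.
  by rewrite linear0.
have A_neq0 : A != 0.
  by apply: contraNneq v_neq0 => A0; rewrite -(vec_mxK v) -/A A0 linear0.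
exists (fun i => rVpoly (row i A)); split=> [||j lt_j].
- apply/existsP; rewrite -negb_forall; apply: contra A_neq0 => /forallP A0.
  apply/eqP/row_matrixP => i; rewrite row0; apply: (can_inj rVpolyK).
  by rewrite linear0; apply/eqP.
- by move=> i; apply: size_poly.
(* Only the coefficients below [E] were imposed; the others vanish by degree. *)
apply/polyP => l; rewrite coef0; have [lt_l|le_l] := ltnP l E; last first.
  apply: nth_default; apply: leq_trans le_l; apply: leq_trans (size_sum _ _ _) _.
  apply/bigmax_leqP => i _; apply: leq_trans (size_iter_node_deriv _ _ _ _ _) _.
  by rewrite leq_add ?size_poly // leq_mul // ltnW.
by have /matrixP/(_ (Ordinal lt_j) (Ordinal lt_l)) := gA0; rewrite !mxE.
Qed.

Lemma size_node_power S : (size (node_power z m S) <= (#|S| * m).+1)%N.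
Proof.
apply: leq_trans (size_poly_prod_leq _ _) _.
rewrite (eq_bigr (fun=> m.+1)) => [|t _]; last by rewrite size_exp_XsubC.
by rewrite sum_nat_const mulnS leq_subLR addnS.
Qed.

Lemma node_power_neq0 S : node_power z m S != 0.
Proof. by apply/prodf_neq0 => t _; rewrite expf_neq0 // polyXsubC_eq0. Qed.

Lemma iter_sum_node_power r (S : 'I_r -> {set I}) (c : 'I_r -> {poly F}) j :
  iter j (fun x => node_poly z * x^`()) (\sum_i c i * node_power z m (S i))
  = \sum_i iter j (node_deriv z m (S i)) (c i) * node_power z m (S i).
Proof.
elim: j => //= j ->; rewrite linear_sum mulr_sumr; apply: eq_bigr => i _ /=.
by rewrite node_derivE.
Qed.

(** A zero sum has zero iterated derivatives, which would put a nonzero vector of node powers in the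
    kernel of the Wronskian. *)
Lemma sum_node_power_neq0 p D r (S : 'I_r -> {set I}) (c : 'I_r -> {poly F}) :
    p \in [pchar F] -> injective z -> injective S ->
    (exists i, c i != 0) -> (forall i, size (c i) <= D)%N ->
    (r * (D + r * #|I|) < m)%N -> (m + r * (D + r * #|I|) < p)%N ->
  \sum_i c i * node_power z m (S i) != 0.
Proof.
move=> charp z_inj S_inj [i0 ci0] sc ltm ltp.
(* The Wronskian lemma needs every coefficient nonzero, so zero ones are discarded. *)
pose J := [set i | c i != 0]; pose e (k : 'I_#|J|) := enum_val k.
have leJ : (#|J| * (D + #|J| * #|I|) <= r * (D + r * #|I|))%N.
  have : (#|J| <= r)%N by rewrite -[leqRHS]card_ord max_card.
  by move=> leJ; rewrite leq_mul // leq_add2l leq_mul.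
have e_neq0 k : c (e k) != 0 by have := enum_valP k; rewrite inE.
have detW : \det (node_wronskian z m (S \o e) (c \o e)) != 0.
  apply: (det_node_wronskian_neq0 charp z_inj (D := D)) => //=.
  - exact: inj_comp S_inj enum_val_inj.
  - exact: leq_ltn_trans leJ ltm.
  by apply: leq_ltn_trans ltp; rewrite leq_add2l.
apply/eqP => sum0; pose f := \col_k node_power z m (S (e k)).
have Wf0 : node_wronskian z m (S \o e) (c \o e) *m f = 0.
  apply/matrixP => j k; rewrite !mxE.
  have := iter_sum_node_power S c j; rewrite sum0.
  have -> : iter j (fun x => node_poly z * x^`()) 0 = 0.
    by elim: (j : nat) => //= n ->; rewrite derivC mulr0.
  rewrite (bigID (mem J)) /= [X in _ + X]big1 ?addr0 => [|i].
    rewrite big_enum_val => eq0; rewrite [RHS]eq0.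
    by apply: eq_bigr => i _; rewrite !mxE.
  rewrite inE negbK => /eqP ->.
  have -> : iter j (node_deriv z m (S i)) 0 = 0; last by rewrite mul0r.
  by elim: (j : nat) => //= n ->; rewrite /node_deriv derivC !mulr0 addr0.
have i0J : i0 \in J by rewrite inE.
have := congr1 (fun v => (\adj (node_wronskian z m (S \o e) (c \o e)) *m v)
  (enum_rank_in i0J i0) ord0) Wf0.
rewrite /= mulmxA mul_adj_mx mul_scalar_mx mulmx0 !mxE => /eqP.
by rewrite mulf_eq0 (negPf detW) (negPf (node_power_neq0 _)).
Qed.

(** On [A] all [T] node powers of pairs equal [mu ^+ 2], so some combination of size at most
    [k * M + 2 * m] vanishes to order [M] at each point of [A]. *)
Theorem stepanov_shifts p M (A : seq F) (mu : F) :
    p \in [pchar F] -> injective z -> uniq A -> mu != 0 ->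
    (forall a t, a \in A -> (a - z t) ^+ m = mu) ->
    let k := #|I| in let T := 'C(k, 2) in
    (M.*2 < T)%N -> (T * (k * M + T * k) < m)%N ->
    (m + T * (k * M + T * k) < p)%N ->
  (size A * M < k * M + m.*2)%N.
Proof.
move=> charp z_inj uA mu_neq0 Amu k T lt_MT ltm ltp.
have m_gt0 : (0 < m)%N by case: (m) ltm.
have [->|M_gt0] := posnP M; first by rewrite !muln0 add0n double_gt0.
have k_gt0 : (0 < k)%N.
  by rewrite lt0n; apply: contraTneq lt_MT => k0; rewrite /T k0.
have cardT : #|[set S : {set I} | #|S| == 2%N]| = T by rewrite card_draws.
pose S (i : 'I_T) : {set I} := enum_val (cast_ord (esym cardT) i).
have S_inj : injective S by move=> i j /enum_val_inj/cast_ord_inj.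
have cardS i : #|S i| = 2%N.
  by have := enum_valP (cast_ord (esym cardT) i); rewrite inE => /eqP.
(* With [D = k * M] the dimension count reduces to [2 * M < T]. *)
have [|c [c_neq0 sc c_rel]] := @ex_node_relation T M (k * M) S.
  rewrite [(M * #|I|)%N]mulnC addnn -muln2 mulnC -mulnA [(T * _)%N]mulnC.
  by rewrite ltn_pmul2l ?muln_gt0 ?k_gt0 //; lia.
pose u := \sum_i c i * node_power z m (S i).
have u_neq0 : u != 0.
  by apply: (sum_node_power_neq0 charp z_inj S_inj c_neq0 sc).
have su : (size u <= k * M + m.*2)%N.
  apply: leq_trans (size_sum _ _ _) _; apply/bigmax_leqP => i _.
  apply: leq_trans (size_polyMleq _ _) _.
  have := size_node_power (S i); rewrite cardS mul2n => sf.
  by have := leq_add (sc i) sf; rewrite addnS; lia.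
apply: leq_trans su; apply: size_mup_roots => // a aA.
have Pa : (node_poly z).[a] != 0.
  rewrite horner_prod; apply/prodf_neq0 => t _; rewrite hornerXsubC.
  apply: contraNneq mu_neq0 => at0.
  by rewrite -(Amu a t aA) at0 expr0n eqn0Ngt m_gt0.
apply: (leq_mup_iter charp _ Pa u_neq0).
  apply: ltnW; apply: leq_ltn_trans ltp; apply: leq_trans (leq_addr _ _).
  apply: leq_trans (ltnW ltm); nia.
move=> j lt_j; rewrite iter_sum_node_power horner_sum.
transitivity ((\sum_i iter j (node_deriv z m (S i)) (c i)).[a] * mu ^+ 2).
  rewrite horner_sum mulr_suml; apply: eq_bigr => i _; rewrite hornerM.
  congr (_ * _); rewrite horner_prod -(cardS i) -prodr_const.
  by apply: eq_bigr => t _; rewrite horner_exp hornerXsubC Amu.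
by rewrite c_rel // horner0 mul0r.
Qed.
End Stepanov.

(** * Hilbert cubes *)

Section Cube.
Variable V : finZmodType.

Lemma hilbert_cube0 (a0 : V) (a : 'I_0 -> V) : hilbert_cube a0 a = [set a0].
Proof.
apply/setP => x; rewrite inE; apply/imsetP/eqP => [[e _ ->]|->].
  by rewrite big_ord0 addr0.
by exists [ffun=> false]; rewrite ?big_ord0 ?addr0.
Qed.

Lemma hilbert_cubeS d (a0 : V) (a : 'I_d.+1 -> V) :
  let H := hilbert_cube a0 (fun i => a (lift ord0 i)) in
  hilbert_cube a0 a = H :|: [set a ord0 + x | x in H].
Proof.
move=> H; apply/setP => x; rewrite inE; apply/imsetP/orP => [[e _ ->]|].
  have memH : a0 + \sum_(i < d) a (lift ord0 i) *+ e (lift ord0 i) \in H.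
    apply/imsetP; exists [ffun i => e (lift ord0 i)] => //.
    by congr (_ + _); apply: eq_bigr => i _; rewrite ffunE.
  rewrite big_ord_recl; case: (e ord0); last by left; rewrite mulr0n add0r.
  by right; apply/imsetP; eexists; first exact: memH; rewrite mulr1n addrCA.
pose ext (b : bool) (e : {ffun 'I_d -> bool}) : {ffun 'I_d.+1 -> bool} :=
  [ffun i => if unlift ord0 i is Some j then e j else b].
have extE b e : a0 + \sum_(i < d.+1) a i *+ ext b e i
    = a ord0 *+ b + (a0 + \sum_(i < d) a (lift ord0 i) *+ e i).
  rewrite big_ord_recl ffunE unlift_none addrCA; congr (_ + (_ + _)).
  by apply: eq_bigr => i _; rewrite ffunE liftK.
case=> [/imsetP[e _ ->]|/imsetP[_ /imsetP[e _ ->] ->]].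
  by exists (ext false e); rewrite // extE mulr0n add0r.
by exists (ext true e); rewrite // extE mulr1n.
Qed.

(** A generator at most doubles a cube, so peeling generators off lands between [K] and [2 * K]; the
    cube left is [B], and the peeled generators span [A]. *)
Lemma hilbert_cube_split K d (a0 : V) (a : 'I_d -> V) :
    (0 < K <= #|hilbert_cube a0 a|)%N ->
  exists A B : {set V}, hilbert_cube a0 a = [set x + y | x in A, y in B] /\
    (K <= #|B| <= K.*2)%N.
Proof.
case/andP=> K_gt0; elim: d a => [|d IH] a.
  rewrite hilbert_cube0 cards1 => leK; exists [set 0], [set a0].
  by rewrite imset2_set1l imset_set1 add0r cards1 leK; split=> //; lia.
have [small|large] := leqP #|hilbert_cube a0 a| K.*2 => leK.
  exists [set 0], (hilbert_cube a0 a); rewrite leK small; split=> //.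
  rewrite imset2_set1l (eq_imset _ (fun x => add0r x)).
  by rewrite imset_id.
have [|A [B [defH cardB]]] := IH (fun i => a (lift ord0 i)).
  move: large; rewrite hilbert_cubeS; set H := hilbert_cube _ _ => large.
  have [] := leq_card_setU H [set a ord0 + x | x in H].
  by rewrite (card_imset _ (addrI _)) => ? _; lia.
exists (A :|: [set a ord0 + x | x in A]), B; split=> //.
rewrite hilbert_cubeS defH; apply/setP => x; rewrite inE.
apply/orP/imset2P => [[/imset2P[y w yA wB ->]|]|[y w]].
- by exists y w; rewrite // inE yA.
- case/imsetP=> _ /imset2P[y w yA wB ->] ->.
  by exists (a ord0 + y) w; rewrite ?addrA // inE imset_f ?orbT.
rewrite inE => /orP[yA|/imsetP[y' yA ->]] wB ->.
  by left; apply: imset2_f.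
by right; rewrite -addrA; apply/imset_f/imset2_f.
Qed.
End Cube.

(** * Cosets of subgroups and the numerical choices *)

Lemma card_unit_coset (A : finUnitRingType) (l : {unit A}) (G : {set {unit A}}) :
  (#|unit_coset l G| <= #|G|)%N.
Proof. exact: leq_imset_card. Qed.

Lemma unit_cosetX (A : finComUnitRingType) (l : {unit A})
    (G : {group {unit A}}) x :
  x \in unit_coset l G -> x ^+ #|G| = val l ^+ #|G|.
Proof.
case/imsetP=> g gG ->; rewrite exprMn -(FinRing.val_unitX _ g) expg_cardG //.
by rewrite mulr1.
Qed.

(** The index is at least 2. For ['F_p] this puts the degree [2 * m] below [p]. *)
Lemma card_proper_units (F : finFieldType) (G : {group {unit F}}) :
  G \proper [set: {unit F}] -> (#|G|.*2 < #|F|)%N.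
Proof.
move=> ltG; have F_gt0 : (0 < #|F|)%N by apply/card_gt0P; exists 0.
have := proper_card ltG; have := cardSg (subsetT G).
rewrite card_finField_unit => /dvdnP[[|[|q]]] eqF; rewrite eqF ?mulSn; lia.
Qed.

(** [M] is the largest integer with [2 * M < T]. The last constant is [32 * 8 * 48 = 12288], rounded
    up. *)
Lemma choose2_bounds N k : (0 < N)%N -> (N.*2.*2 <= k <= 8 * N)%N ->
  let T := 'C(k, 2) in let M := T.-1./2 in
  [/\ (M.*2 < T)%N, (2 * N ^ 2 <= M)%N &
      (T * (k * M + T * k) <= 128 * 100 * N ^ 5)%N].
Proof.
move=> N_gt0 /andP[leNk lekN] T M.
have defT : T.*2 = (k * k.-1)%N.
  rewrite /T bin2 -[RHS]odd_double_half oddM; case: k {leNk lekN T M} => //= k.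
  by rewrite andbC; case: (odd k).
have lowT : (6 * N ^ 2 <= T)%N by rewrite expnS expn1; nia.
have upT : (T <= 32 * N ^ 2)%N by rewrite expnS expn1; nia.
have sqN : (0 < N ^ 2)%N by rewrite expn_gt0 N_gt0.
have defM : (M.*2 <= T.-1 <= M.*2.+1)%N.
  by rewrite /M -{2 3}(odd_double_half T.-1); case: (odd _); lia.
split; [lia | lia |].
have leM : (M <= 16 * N ^ 2)%N by lia.
have : (k * M + T * k <= 8 * N * (48 * N ^ 2))%N.
  by rewrite [(T * k)%N]mulnC -mulnDr leq_mul //; lia.
move=> le2; apply: leq_trans (leq_mul upT le2) _.
have -> : (N ^ 5 = N * N ^ 2 * N ^ 2)%N by rewrite -!expnS -expnD.
by move: (N ^ 2)%N => Q; nia.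
Qed.

(** Stepanov's bound gives [#|H| <= k ^ 2 + k * p / M], at most [64 * N ^ 2 + 16384 * N ^ 11]. A
    cube of size [20000 * N ^ 11] also forces [m] above the [12800 * N ^ 5] that the method
    requires. *)
Lemma hilbert_cube_coset_bound p N (H : {set 'F_p}) (G : {group {unit 'F_p}})
    (l : {unit 'F_p}) :
    prime p -> (p < N.+1 ^ 12)%N -> (0 < N)%N ->
    is_hilbert_cube H -> G \proper [set: {unit 'F_p}] ->
    H \subset unit_coset l G ->
  (#|H| < 200 * 100 * N ^ 11)%N.
Proof.
move=> p_pr ltpN N_gt0 [d [a0 [a defH]]] ltG sHG.
rewrite ltnNge; apply/negP => largeH.
have powN i : (i <= 11)%N -> (N ^ i <= N ^ 11)%N by move=> ?; rewrite leq_pexp2l.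
have [leN1 leN2 leN5] : [/\ N <= N ^ 11, N ^ 2 <= N ^ 11 & N ^ 5 <= N ^ 11]%N.
  by split; rewrite ?powN // -{1}[N]expn1 powN.
(* Here [N + 1 <= 2 * N], and [4096 = 2 ^ 12]. *)
have ltpQ : (p < 4096 * (N * N ^ 11))%N.
  rewrite -expnS; apply: leq_trans ltpN _.
  rewrite -[4096%N]/(2 ^ 12)%N -expnMn leq_exp2r //.
  by rewrite mul2n -addnn -addn1 leq_add2l.
move: (N ^ 11)%N leN1 leN2 leN5 ltpQ largeH {powN ltpN}.
move=> Q leN1 leN2 leN5 ltpQ largeH.
have leHm : (#|H| <= #|G|)%N.
  exact: leq_trans (subset_leq_card sHG) (card_unit_coset l G).
have ltmp := card_proper_units ltG; rewrite card_Fp // in ltmp.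
have [|A [B []]] := @hilbert_cube_split _ (N.*2.*2) d a0 a.
  by rewrite -defH; apply/andP; split; [lia | apply: leq_trans largeH; lia].
rewrite -defH => sumH cardB.
set k := #|B| in cardB.
have cardk : (N.*2.*2 <= k <= 8 * N)%N by lia.
have [lt_MT leM leL] := choose2_bounds N_gt0 cardk.
set T := 'C(k, 2) in lt_MT leM leL; set M := T.-1./2 in lt_MT leM leL.
have leHAB : (#|H| <= #|A| * k)%N.
  by rewrite sumH curry_imset2X -cardsX leq_imset_card.
(* The sign makes [x - z i] the element [x + b] of the cube. *)
pose z (i : 'I_k) : 'F_p := - enum_val i.
have z_inj : injective z by move=> i j /oppr_inj/enum_val_inj.
have ltL : (T * (k * M + T * k) < #|G|)%N.
  apply: leq_ltn_trans leL _; apply: leq_trans leHm; apply: leq_trans largeH.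
  by move: (N ^ 5)%N leN5 => N5 leN5; lia.
have := @stepanov_shifts _ _ z #|G| p M (enum A) (val l ^+ #|G|)
  (pchar_Fp p_pr) z_inj.
rewrite /= card_ord -cardE -/T => /(_ (enum_uniq _)).
have -> : val l ^+ #|G| != 0.
  by rewrite expf_neq0 // -unitfE (valP l).
move=> /(_ isT) stepanov.
have {stepanov} bound : (#|A| * M < k * M + #|G|.*2)%N.
  apply: (stepanov _ lt_MT ltL _); last first.
    by apply: ltn_trans ltmp; rewrite -addnn ltn_add2l.
  move=> x t; rewrite mem_enum => xA; rewrite opprK; apply: unit_cosetX.
  by apply: (subsetP sHG); rewrite sumH imset2_f // enum_valP.
have ltHM : (#|H| * M <= k * (k * M + p))%N.
  apply: leq_trans (leq_mul leHAB (leqnn M)) _.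
  rewrite [(#|A| * k)%N]mulnC -mulnA leq_mul //.
  by apply: ltnW; apply: ltn_trans bound _; rewrite ltn_add2l.
have lek8 : (k <= 8 * N)%N by case/andP: cardk.
have lek2 : (k * k <= 64 * N ^ 2)%N.
  by apply: leq_trans (leq_mul lek8 lek8) _; rewrite mulnACA.
have lekp : (k * p <= 8 * 4096 * (N ^ 2 * Q))%N.
  apply: leq_trans (leq_mul lek8 (ltnW ltpQ)) _.
  by rewrite expnS expn1; lia.
have : (200 * 100 * Q * M <= 64 * Q * M + 8 * 4096 * (N ^ 2 * Q))%N.
  apply: leq_trans (leq_mul largeH (leqnn M)) _; apply: leq_trans ltHM _.
  rewrite mulnDr mulnA leq_add // leq_mul //.
  by apply: leq_trans lek2 _; rewrite leq_mul.
have Q_gt0 : (0 < Q)%N by lia.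
have : (2 * N ^ 2 * Q <= M * Q)%N by rewrite leq_mul.
have : (0 < N ^ 2 * Q)%N by rewrite muln_gt0 expn_gt0 N_gt0.
move: (N ^ 2)%N => N2; lia.
Qed.

(** * Integer roots and the passage to real exponents *)

Lemma ex_root_bounds n p : (0 < n)%N -> (0 < p)%N ->
  exists2 N, (0 < N)%N & (N ^ n <= p < N.+1 ^ n)%N.
Proof.
move=> n_gt0 p_gt0.
have ex1 : exists N, (N ^ n <= p)%N by exists 1%N; rewrite exp1n.
have ub N : (N ^ n <= p)%N -> (N <= p)%N.
  by apply: leq_trans; case: N => // N; rewrite -{1}[N.+1]expn1 leq_pexp2l.
case: (ex_maxnP ex1 ub) => N leN maxN; exists N; first by rewrite maxN // exp1n.
by rewrite leN ltnNge; apply/negP => /maxN; rewrite ltnn.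
Qed.

Import Order.TTheory Num.Theory.

Lemma natrX_le_powR (R : realType) (N p i n : nat) : (0 < n)%N ->
  (N ^ n <= p)%N -> (N ^ i)%:R <= p%:R `^ (i%:R / n%:R) :> R.
Proof.
move=> n_gt0 leNp; have n_neq0 : n%:R != 0 :> R by rewrite pnatr_eq0 -lt0n.
have -> : (N ^ i)%:R = (N ^ n)%:R `^ (i%:R / n%:R) :> R.
  rewrite !natrX -(powR_mulrn n (ler0n _ _)) -powRrM mulrCA divff // mulr1.
  by rewrite powR_mulrn ?ler0n.
by apply: ge0_ler_powR; rewrite ?nnegrE ?divr_ge0 ?ler0n // ler_nat.
Qed.

Theorem corollary1p3 (R : realType) :
  exists C : R, forall p : nat, prime p ->
    forall H : {set 'F_p}, is_hilbert_cube H ->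
      C * p%:R `^ (11%:R / 12%:R) <= #|H|%:R ->
      forall (G : {group {unit 'F_p}}) (l : {unit 'F_p}),
        G \proper [set: {unit 'F_p}] -> ~~ (H \subset unit_coset l G).
Proof.
(* The constant of the integer bound serves, since [N ^ 11 <= p ^ (11/12)] for the integer twelfth
   root [N] of [p]. *)
exists (200 * 100)%N%:R => p p_pr H cubeH largeH G l ltG; apply/negP => sHG.
have [N N_gt0 /andP[leNp ltpN]] :=
  ex_root_bounds (isT : 0 < 12)%N (prime_gt0 p_pr).
have := hilbert_cube_coset_bound p_pr ltpN N_gt0 cubeH ltG sHG.
rewrite ltnNge => /negP; apply; rewrite -(ler_nat R) natrM.
apply: le_trans largeH; apply: ler_wpM2l; first exact: ler0n.
exact: natrX_le_powR.
Qed.
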